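(* If $G$ is a graph with chromatic number $\chi$, then $$\|G\|_{F_\chi}\ge 2\sigma_1(G).$$
   Context: Graphs are finite, simple and undirected. For a graph $G$ of order $n$ (number of vertices) with adjacency matrix $A$, let $\sigma_1(G)\ge\cdots\ge\sigma_n(G)$ be the singular values of $A$ (the absolute values of its eigenvalues), and for an integer $k\ge1$ let $\|G\|_{F_k}=\sigma_1(G)+\cdots+\sigma_k(G)$ be the Ky Fan $k$-norm. *)

(* Defs.v *)
From HB Require Import structures.
From mathcomp Require Import all_boot all_order all_algebra.
From mathcomp Require Import polyrcf.

Set Implicit Arguments.
Unset Strict Implicit.
Unset Printing Implicit Defensive.

Import Order.TTheory GRing.Theory Num.Theory.

Local Open Scope ring_scope.

Record sgraph := SGraph {
  vertex :> finType;
  adj : rel vertex;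
  adj_sym : symmetric adj;
  adj_irrefl : irreflexive adj
}.

Definition colorable (G : sgraph) (k : nat) : bool :=
  [exists f : {ffun G -> 'I_k},
    [forall x : G, forall y : G, adj x y ==> (f x != f y)]].

Lemma colorable_order (G : sgraph) : colorable G #|G|.
Proof.
apply/existsP; exists [ffun x => enum_rank x].
apply/forallP => x; apply/forallP => y; apply/implyP => xy.
rewrite !ffunE; apply: contraTneq xy => /enum_rank_inj ->.
by rewrite adj_irrefl.
Qed.

Definition chromatic_number (G : sgraph) : nat :=
  ex_minn (ex_intro (fun k => colorable G k) _ (colorable_order G)).

Definition adjacency_matrix (R : nzRingType) (G : sgraph) : 'M[R]_#|G| :=
  \matrix_(i, j) (adj (enum_val i : G) (enum_val j))%:R.

(* The eigenvalues lying in R, each repeated according to its algebraic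
   multiplicity. This is the whole spectrum when A is symmetric. *)
Definition eigenvalues (R : rcfType) (n : nat) (A : 'M[R]_n) : seq R :=
  flatten [seq nseq (mup x (char_poly A)) x | x <- rootsR (char_poly A)].

Definition singular_values (R : rcfType) (m n : nat) (A : 'M[R]_(m, n)) :
    seq R :=
  sort >=%R [seq Num.sqrt x | x <- eigenvalues (A^T *m A)].

(* Indices start at 1, and singular_value A i is 0 for i beyond the width
   of A. The value at the index 0 is meaningless. *)
Definition singular_value (R : rcfType) (m n : nat) (A : 'M[R]_(m, n))
    (i : nat) : R :=
  (singular_values A)`_i.-1.

Definition ky_fan_norm (R : rcfType) (m n : nat) (k : nat)
    (A : 'M[R]_(m, n)) : R :=
  \sum_(1 <= i < k.+1) singular_value A i.

(* Main.v *)
(** Diagonalize the adjacency matrix A with orthonormal eigenvectors v_j and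
    eigenvalues d_j, let x = v_j0 where |d_j0| is largest, let x_c be the
    restriction of x to the colour class c, and put
    t_j = \sum_c |<v_j, x_c>|^2 / |x_c|^2.  Since A vanishes on each colour
    class, \sum_j d_j |<v_j, x_c>|^2 = <A x_c, x_c> = 0, so
    \sum_j d_j t_j = 0; as t_j0 = 1, this yields
    2 |d_j0| <= \sum_j |d_j| t_j.  The normalized nonzero x_c are orthonormal,
    so 0 <= t_j <= 1 and \sum_j t_j is at most the number of colours k, and the
    weighted sum is at most the sum of the k largest |d_j|. *)

Require Import Defs.
From mathcomp Require Import all_boot all_order all_algebra.
From mathcomp Require Import polyrcf complex spectral sesquilinear.
From mathcomp Require Import ring.

Set Implicit Arguments.
Unset Strict Implicit.
Unset Printing Implicit Defensive.

Import Order.TTheory GRing.Theory Num.Theory.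
Local Open Scope ring_scope.

Lemma ler_weighted_sum_sorted (R : realDomainType) (I : finType) (d t : I -> R)
    (k : nat) (s : seq R) :
    perm_eq s [seq d j | j <- enum I] -> sorted >=%R s ->
    (forall j, 0 <= d j) -> (forall j, 0 <= t j <= 1) ->
    \sum_j t j <= k%:R ->
  \sum_j d j * t j <= \sum_(i < k) s`_i.
Proof.
move=> ps ss d0 t01 tk.
(* For any m >= 0 the weighted sum is at most \sum_j max (d_j - m) 0 + m k; this
   bound is sharp when m is a (k+1)-st largest term. *)
pose m := s`_k.
have s0 i : 0 <= s`_i.
  case: (ltnP i (size s)) => [/(mem_nth 0)|/(nth_default 0) -> //].
  by rewrite (perm_mem ps) => /mapP[j _ ->].
have smono i j : (i <= j)%N -> s`_j <= s`_i.
  move=> ij; case: (ltnP j (size s)) => [js|/(nth_default 0) ->//].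
  by apply: (sorted_leq_nth ge_trans ge_refl 0 ss) => //;
    exact: leq_ltn_trans js.
have step : \sum_j d j * t j <= \sum_j Num.max (d j - m) 0 + m * k%:R.
  apply: le_trans (_ : \sum_j (d j - m) * t j + m * \sum_j t j <= _).
    rewrite mulr_sumr -big_split /=.
    by apply: ler_sum => j _; rewrite mulrBl subrK.
  apply: lerD; last exact: (ler_wpM2l (s0 k)).
  apply: ler_sum => j _; have /andP[t0 t1] := t01 j.
  case: (lerP 0 (d j - m)) => h; last by rewrite nmulr_rle0.
  by rewrite ler_piMr.
apply: le_trans step _.
have -> : \sum_j Num.max (d j - m) 0 = \sum_(i < size s) Num.max (s`_i - m) 0.
  rewrite -(big_mkord xpredT (fun i => Num.max (s`_i - m) 0)).
  rewrite -(big_nth 0 xpredT (fun x => Num.max (x - m) 0)).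
  by rewrite (perm_big _ ps) big_map big_enum.
have le1 : \sum_(i < size s) Num.max (s`_i - m) 0 <= \sum_(i < k) (s`_i - m).
  (* As [k] may exceed [size s], the sum is first padded to [size s + k] terms, then split at [k];
     sortedness makes every term from [k] on vanish. *)
  have sp N : \sum_(i < N) Num.max (s`_i - m) 0
      <= \sum_(i < N + k) Num.max (s`_i - m) 0.
    rewrite big_split_ord /= lerDl sumr_ge0 // => i _.
    by rewrite le_max lexx orbT.
  apply: le_trans (sp _) _; rewrite addnC big_split_ord /=.
  rewrite [X in _ + X]big1 ?addr0 => [|i _].
    by apply: ler_sum => i _; rewrite max_l // subr_ge0 smono // ltnW.
  by rewrite max_r // subr_le0 smono // leq_addr.
apply: le_trans (lerD le1 (lexx _)) _.
by rewrite sumrB sumr_const card_ord mulr_natr subrK.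
Qed.

Lemma mup_prod_XsubC (F : fieldType) (x : F) (s : seq F) :
  mup x (\prod_(a <- s) ('X - a%:P)) = count_mem x s.
Proof.
elim: s => [|a s IH]; first by rewrite big_nil mupNroot // root1.
rewrite big_cons mupM ?polyXsubC_eq0 ?(monic_neq0 (monic_prod_XsubC _ _ _)) //.
by rewrite IH /= -['X - a%:P]expr1 mup_XsubCX; case: eqP.
Qed.

Lemma perm_eigenvalues (R : rcfType) (n : nat) (A : 'M[R]_n) (s : seq R) :
  char_poly A = \prod_(a <- s) ('X - a%:P) -> perm_eq (eigenvalues A) s.
Proof.
move=> cA; apply/allP => x _ /=; apply/eqP; rewrite /eigenvalues count_flatten.
rewrite -map_comp sumnE big_map.
(* Only the block of copies of [x] contributes to the count, and it occurs once at most because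
   [rootsR] has no repetitions. *)
rewrite (eq_bigr (fun y => if y == x then mup x (char_poly A) else 0%N)).
  rewrite -big_mkcond /= big_const_seq iter_addn_0.
  have u : uniq (rootsR (char_poly A)) by apply: uniq_roots.
  have p0 : char_poly A != 0 by rewrite monic_neq0 ?char_poly_monic.
  rewrite -/(count_mem x _) (count_uniq_mem _ u).
  rewrite -(roots_on_rootsR p0) /= -mup_prod_XsubC -cA.
  by case: (boolP (root _ _)) => [_|/mupNroot ->]; rewrite ?muln1.
move=> y _ /=; rewrite count_nseq /=; by case: eqP => [->|_]; rewrite ?mul1n.
Qed.

Lemma char_poly_similar (R : comUnitRingType) (n : nat) (P A : 'M[R]_n) :
  P \in unitmx -> char_poly (invmx P *m A *m P) = char_poly A.
Proof.
move=> uP; rewrite /char_poly.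
have PK : map_mx polyC (invmx P) *m map_mx polyC P = 1%:M.
  by rewrite -map_mxM mulVmx ?map_mx1.
have -> : char_poly_mx (invmx P *m A *m P)
    = map_mx polyC (invmx P) *m char_poly_mx A *m map_mx polyC P.
  rewrite /char_poly_mx mulmxBr mulmxBl !map_mxM; congr (_ - _).
  by rewrite -mulmxA -scalar_mxC mulmxA PK mul1mx.
by rewrite !det_mulmx mulrAC -det_mulmx PK det1 mul1r.
Qed.

(** Over the algebraically closed field [R[i]] the matrix is Hermitian, hence unitarily
    diagonalizable with real spectrum; so [d] descends to [R] while [U] stays complex. *)
Lemma realsym_spectral (R : rcfType) (n : nat) (A : 'M[R]_n) : A^T = A ->
  exists U : 'M[R[i]]_n, exists2 d : 'rV[R]_n, U \is unitarymx &
    map_mx (real_complex R) A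
      = invmx U *m diag_mx (map_mx (real_complex R) d) *m U.
Proof.
move=> symA; pose B := map_mx (real_complex R) A.
have hB : B \is hermsymmx.
  apply: realsym_hermsym.
    apply/is_hermitianmxP; rewrite expr0 scale1r map_mx_id //.
    by rewrite /B -{1}symA map_trmx.
  apply/mxOverP => i j; rewrite mxE; apply/complex_realP; by exists (A i j).
have /mxOverP dR := hermitian_spectral_diag_real hB.
exists (spectralmx B), (map_mx (@complex.Re R) (spectral_diag B)).
  exact: spectral_unitarymx.
have -> : map_mx (real_complex R) (map_mx (@complex.Re R) (spectral_diag B))
    = spectral_diag B.
  by apply/rowP => j; rewrite !mxE; apply: RRe_real; exact: dR.
exact/orthomx_spectralP/hermitian_normalmx.
Qed.

(** Here [A^T *m A] is the square of [A], similar to the diagonal matrix of the squares of [d]. The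
    characteristic polynomials are compared over [R[i]], where [U] lives. *)
Lemma perm_singular_values_sym (R : rcfType) (n : nat) (A : 'M[R]_n)
    (U : 'M[R[i]]_n) (d : 'rV[R]_n) : A^T = A -> U \in unitmx ->
    map_mx (real_complex R) A
      = invmx U *m diag_mx (map_mx (real_complex R) d) *m U ->
  perm_eq (singular_values A) [seq `|d 0 j| | j <- enum 'I_n].
Proof.
move=> symA uU eA; rewrite /singular_values perm_sort.
have -> : [seq `|d 0 j| | j <- enum 'I_n]
    = [seq Num.sqrt x | x <- [seq d 0 j ^+ 2 | j <- enum 'I_n]].
  by rewrite -[RHS]map_comp; apply: eq_map => j; rewrite /= sqrtr_sqr.
apply/perm_map/perm_eigenvalues.
apply: (@map_poly_inj _ _ (real_complex R)).
rewrite map_char_poly symA map_mxM eA.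
rewrite -!mulmxA (mulmxA U (invmx U)) mulmxV // mul1mx.
rewrite (mulmxA (diag_mx _) (diag_mx _)) mulmx_diag mulmxA char_poly_similar //.
rewrite char_poly_trig ?diag_mx_is_trig // rmorph_prod big_map big_enum /=.
apply: eq_bigr => j _; rewrite rmorphB /= map_polyX map_polyC /= !mxE.
by rewrite eqxx mulr1n rmorphXn.
Qed.

Lemma CauchySchwarz_sum (C : numClosedFieldType) (n : nat) (P : pred 'I_n)
    (u v : 'I_n -> C) :
  `|\sum_(p | P p) u p * (v p)^*| ^+ 2
    <= (\sum_(p | P p) u p * (u p)^*) * (\sum_(p | P p) v p * (v p)^*).
Proof.
pose r (w : 'I_n -> C) : 'rV[C]_n := \row_p (if P p then w p else 0).
have rE w z : dotmx (r w) (r z) = \sum_(p | P p) w p * (z p)^*.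
  rewrite dotmxE mxE [RHS]big_mkcond; apply: eq_bigr => p _; rewrite !mxE.
  by case: ifP => _; rewrite ?mul0r.
by rewrite -!rE; exact: (CauchySchwarz (@dotmx C n)).
Qed.

Lemma coloring_weights (C : numClosedFieldType) (n k : nat) (f : 'I_n -> 'I_k)
    (A U : 'M[C]_n) (d : 'rV[C]_n) (j0 : 'I_n) :
    U \is unitarymx -> A = invmx U *m diag_mx d *m U ->
    (forall p q, f p = f q -> A p q = 0) ->
  exists t : 'I_n -> C,
    [/\ forall j, 0 <= t j <= 1, t j0 = 1, \sum_j t j <= k%:R
      & \sum_j d 0 j * t j = 0].
Proof.
move=> uU eA A0; rewrite (invmx_unitary uU) in eA.
have AE p q : A p q = \sum_j (U j p)^* * d 0 j * U j q.
  by rewrite eA mul_mx_diag mxE; apply: eq_bigr => j _; rewrite !mxE.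
have rowU i j : \sum_p U i p * (U j p)^* = (i == j)%:R.
  have /unitarymxP/matrixP/(_ i j) := uU; rewrite !mxE => <-.
  by apply: eq_bigr => p _; rewrite !mxE.
have colU p q : \sum_j (U j p)^* * 1 * U j q = (p == q)%:R.
  have := mulVmx (unitarymx_unit uU); rewrite (invmx_unitary uU).
  move=> /matrixP/(_ p q); rewrite !mxE => <-.
  by apply: eq_bigr => j _; rewrite !mxE mulr1.
pose a j c := \sum_(p | f p == c) U j p * (U j0 p)^*.
(* Summing over [j] first leaves entries of [U^* diag(e) U]: the identity for [e = 1] ([colU]), and
   [A] for [e = d] ([AE]). *)
have a_sum (e : 'I_n -> C) c : \sum_j e j * `|a j c| ^+ 2
    = \sum_(q | f q == c) \sum_(p | f p == c)
        U j0 p * (U j0 q)^* * \sum_j (U j p)^* * e j * U j q.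
  transitivity (\sum_j \sum_(q | f q == c) \sum_(p | f p == c)
      U j0 p * (U j0 q)^* * ((U j p)^* * e j * U j q)).
    apply: eq_bigr => j _; rewrite normCK /a rmorph_sum big_distrlr mulr_sumr.
    apply: eq_bigr => q _; rewrite mulr_sumr; apply: eq_bigr => p _.
    by rewrite rmorphM /= conjCK; ring.
  rewrite exchange_big; apply: eq_bigr => q _; rewrite exchange_big.
  by apply: eq_bigr => p _; rewrite mulr_sumr.
(* The squared norm of row [j0] of [U] restricted to the class [c]. *)
pose w c := a j0 c.
have w_ge0 c : 0 <= w c by apply: sumr_ge0 => p _; rewrite mul_conjC_ge0.
have fibers j : \sum_c \sum_(p | f p == c) U j p * (U j p)^* = 1.
  by have := rowU j j; rewrite eqxx (partition_big f xpredT).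
(* The quotient is 0 when w c = 0, that is, when U j0 vanishes on the class c. *)
exists (fun j => \sum_c `|a j c| ^+ 2 / w c); split.
- move=> j; apply/andP; split.
    by apply: sumr_ge0 => c _; rewrite divr_ge0 ?exprn_ge0.
  (* The unit mass of row [j] splits over the classes, and Cauchy-Schwarz bounds each quotient by
     the mass on its class. *)
  rewrite -(fibers j); apply: ler_sum => c _.
  have := w_ge0 c; rewrite le_eqVlt => /predU1P[<-|w_gt0].
    by rewrite invr0 mulr0 sumr_ge0 // => p _; rewrite mul_conjC_ge0.
  by rewrite ler_pdivrMr //; exact: CauchySchwarz_sum.
- rewrite -(fibers j0); apply: eq_bigr => c _; rewrite -/(a j0 c) -/(w c).
  rewrite ger0_norm ?w_ge0 //; have [->|w0] := eqVneq (w c) 0.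
    by rewrite invr0 mulr0.
  by rewrite expr2 mulfK.
(* By Parseval the numerators for a class [c] add up to [w c], so each class contributes 1, or 0 if
   [w c = 0]. *)
- rewrite exchange_big -[k in k%:R]card_ord -sumr_const.
  apply: ler_sum => c _; rewrite -mulr_suml.
  have -> : \sum_j `|a j c| ^+ 2 = w c.
    under eq_bigr do rewrite -[_ ^+ 2]mul1r.
    rewrite a_sum; apply: eq_bigr => q fq.
    rewrite (bigD1 q) //= colU eqxx mulr1 big1 ?addr0 // => p /andP[_ pq].
    by rewrite colU (negPf pq) mulr0.
  by have [->|w0] := eqVneq (w c) 0; rewrite ?mul0r ?ler01 // divff.
- under eq_bigr do rewrite mulr_sumr.
  rewrite exchange_big big1 // => c _.
  under eq_bigr do rewrite mulrA.
  rewrite -mulr_suml a_sum big1 ?mul0r // => q /eqP fq.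
  by rewrite big1 // => p /eqP fp; rewrite -AE A0 ?mulr0 // fp.
Qed.

Theorem theorem16 (R : rcfType) (G : sgraph) :
  ky_fan_norm (chromatic_number G) (adjacency_matrix R G)
    >= 2 * singular_value (adjacency_matrix R G) 1.
Proof.
rewrite /ky_fan_norm /chromatic_number; case: ex_minnP => k /existsP[f fP] _.
set A := adjacency_matrix R G.
have symA : A^T = A by apply/matrixP => i j; rewrite !mxE adj_sym.
have [U [d uU eA]] := realsym_spectral symA.
have perm_sv := perm_singular_values_sym symA (unitarymx_unit uU) eA.
have sorted_sv : sorted >=%R (singular_values A).
  by apply: sort_sorted => x y; exact: le_total.
rewrite big_add1 big_mkord /singular_value /=.
(* For the empty graph every singular value is the default 0. *)
have [|s_gt0] := leqP (size (singular_values A)) 0.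
  rewrite leqn0 => /nilP ->.
  by rewrite nth_nil mulr0 big1 // => i _; rewrite nth_nil.
have /mapP[j0 _ ->] :
    (singular_values A)`_0 \in [seq `|d 0 j| | j <- enum 'I_#|G|].
  by rewrite -(perm_mem perm_sv) mem_nth.
have A0 p q : f (enum_val p) = f (enum_val q) ->
    map_mx (real_complex R) A p q = 0.
  move=> fpq; rewrite !mxE; case: (boolP (adj _ _)) => // pq.
  by have /forallP/(_ (enum_val p))/forallP/(_ (enum_val q)) := fP;
    rewrite pq fpq eqxx.
have [t [t01 tj0 tk dt0]] := coloring_weights j0 uU eA A0.
(* The weights lie in [R[i]] but are real, so the bounds transfer to their real parts. *)
pose r j := complex.Re (t j).
have rE j : t j = real_complex R (r j).
  by rewrite RRe_real // ger0_real //; case/andP: (t01 j).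
have r01 j : 0 <= r j <= 1.
  by have := t01 j; rewrite rE ler0c -[1]/(1%:C)%C lecR.
have rk : \sum_j r j <= k%:R.
  by rewrite -lecR rmorph_sum rmorph_nat (eq_bigr t).
have dr0 : \sum_j d 0 j * r j = 0.
  apply: (@complexI R); rewrite rmorph0 -dt0 rmorph_sum; apply: eq_bigr => j _.
  by rewrite mxE rE rmorphM.
have rj0 : r j0 = 1 by rewrite /r tj0.
apply: le_trans (ler_weighted_sum_sorted perm_sv sorted_sv _ r01 rk);
  last by move=> j; exact: normr_ge0.
(* Isolating [d 0 j0] in the zero sum bounds its absolute value by the weighted sum over the other
   indices; the term at [j0] supplies the second copy. *)
move: dr0; rewrite (bigD1 j0) //= rj0 mulr1 => /eqP.
rewrite addr_eq0 => /eqP dj0.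
rewrite [leRHS](bigD1 j0) //= rj0 mulr1 mulr_natl mulr2n lerD2l.
rewrite [in leLHS]dj0 normrN; apply: le_trans (ler_norm_sum _ _ _) _.
apply: ler_sum => j _; have /andP[rj_ge0 _] := r01 j.
by rewrite normrM (ger0_norm rj_ge0).
Qed.
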